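(* Let $f_s:\mathbb{R}^{n_s}\to\mathbb{R}$ and $f_c:\mathbb{R}^{n_c}\to\mathbb{R}$ be continuously differentiable and convex, $A_s\in\mathbb{R}^{m\times n_s}$, $A_c\in\mathbb{R}^{m\times n_c}$, $b\in\mathbb{R}^m$. Suppose $f_s$ is $\mu_s$-strongly convex with $l_s$-Lipschitz gradient ($l_sI\succeq\nabla^2f_s\succeq\mu_sI$ wherever defined), $f_c$ is $\mu_c$-strongly convex with $l_c$-Lipschitz gradient ($l_cI\succeq\nabla^2f_c\succeq\mu_cI$ wherever defined), and $A_s$ has full row rank with $\sigma_sI\succeq A_sA_s^T\succeq\kappa_sI$, all constants being positive. Let $$\bar L(x_c,y):=\min_{x_s\in\mathbb{R}^{n_s}}\left\{f_s(x_s)+f_c(x_c)+y^T(A_sx_s+A_cx_c-b)\right\},$$ with unique minimizer $\bar x_s(y)$. Then the reduced primal-dual dynamics $$\dot x_c=-\nabla_{x_c}\bar L(x_c,y)=-\nabla f_c(x_c)-A_c^Ty,\qquad \dot y=\big[\nabla_y\bar L(x_c,y)\big]_y^+=\big[A_s\bar x_s(y)+A_cx_c-b\big]_y^+$$ converge exponentially to the unique saddle point of $\bar L$ on $\mathbb{R}^{n_c}\times\mathbb{R}^m_{\ge0}$: writing $\bar z:=(x_c,y)$, given the unique saddle point $\bar z_\star$ and any initial point $\bar z(0)\in\mathbb{R}^{n_c}\times\mathbb{R}^m_{\ge0}$, $$\|\bar z(t)-\bar z_\star\|\le\|\bar z(0)-\bar z_\star\|e^{-ct}$$ holds (for all $t\ge0$)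 with the rate $c=\min\left\{\mu_c,\frac{\kappa_s}{l_s}\right\}>0$.
   Context: The dynamics are designed to solve $\min f_s(x_s)+f_c(x_c)$ subject to $A_sx_s+A_cx_c-b\le0$, with dual variable $y\in\mathbb{R}^m_{\ge0}$. The minimizer $\bar x_s(y)$ is characterized by $\nabla f_s(\bar x_s(y))+A_s^Ty=0$. For $y\in\mathbb{R}^m_{\ge0}$ and $s\in\mathbb{R}^m$, $[s]_y^+$ is defined componentwise by $([s]_y^+)_j=s_j$ if $y_j>0$ and $([s]_y^+)_j=\max\{s_j,0\}$ if $y_j=0$. Saddle point of $\bar L$: $\bar L(x_{c\star},y)\le\bar L(x_{c\star},y_\star)\le\bar L(x_c,y_\star)$ for all $x_c\in\mathbb{R}^{n_c}$, $y\in\mathbb{R}^m_{\ge0}$. Solutions are in the Carathéodory sense (absolutely continuous, satisfying the equations for almost every $t$, with $y(t)\ge0$). *)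

(* Defs.v *)
From mathcomp Require Export all_boot all_order all_algebra.
From mathcomp Require Export all_classical all_reals all_analysis.

Set Implicit Arguments.
Unset Strict Implicit.
Unset Printing Implicit Defensive.

Export Order.TTheory GRing.Theory Num.Theory.
Export numFieldNormedType.Exports.

#[export] Set Implicit Arguments.
#[export] Unset Strict Implicit.

Global Open Scope classical_set_scope.
Global Open Scope ring_scope.

(* Vectors of R^n are column vectors. The norm `|x| that the library puts on
   matrices is the sup norm: it is used below only through the topology and the
   notion of differentiability it induces (all norms on R^n being equivalent),
   and every quantitative statement uses the Euclidean norm enorm. *)
Definition enorm (R : realType) (n : nat) (x : 'cV[R]_n) : R :=
  Num.sqrt (\sum_(i < n) x i ord0 ^+ 2).

Definition gradient (R : realType) (n : nat) (f : 'cV[R]_n -> R)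
    (x : 'cV[R]_n) : 'cV[R]_n :=
  \col_(i < n) 'D_(delta_mx i ord0) f x.

(* The entries of gradient f x are partial derivatives, which are meaningful as
   a gradient only together with differentiability. *)
Definition has_gradient (R : realType) (n : nat) (f : 'cV[R]_n -> R)
    (x g : 'cV[R]_n) : Prop :=
  differentiable f x /\ gradient f x = g.

Definition continuously_differentiable (R : realType) (n : nat)
    (f : 'cV[R]_n -> R) : Prop :=
  (forall x, differentiable f x) /\ continuous (gradient f).

Definition convex (R : realType) (n : nat) (f : 'cV[R]_n -> R) : Prop :=
  convex_function [set: convex_lmodType 'cV[R]_n] f.

Definition strongly_convex (R : realType) (n : nat) (mu : R)
    (f : 'cV[R]_n -> R) : Prop :=
  forall (x y : 'cV[R]_n) (t : R), 0 <= t -> t <= 1 ->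
    f (t *: x + (1 - t) *: y) <=
    t * f x + (1 - t) * f y - mu / 2 * t * (1 - t) * enorm (x - y) ^+ 2.

Definition lipschitz_gradient (R : realType) (n : nat) (l : R)
    (f : 'cV[R]_n -> R) : Prop :=
  forall x y : 'cV[R]_n,
    enorm (gradient f x - gradient f y) <= l * enorm (x - y).

Definition psdmx (R : realType) (n : nat) (A : 'M[R]_n) : Prop :=
  A^T = A /\ forall v : 'cV[R]_n, 0 <= (v^T *m A *m v) ord0 ord0.

Definition loewner_le (R : realType) (n : nat) (A B : 'M[R]_n) : Prop :=
  psdmx (B - A).

Definition nonneg_vec (R : realType) (m : nat) (y : 'cV[R]_m) : Prop :=
  forall j, 0 <= y j ord0.

(* [s]_y^+, meant for y >= 0 only, so that the else branch is y_j = 0. *)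
Definition proj_plus (R : realType) (m : nat) (y s : 'cV[R]_m) : 'cV[R]_m :=
  \col_(j < m) (if 0 < y j ord0 then s j ord0 else Num.max (s j ord0) 0).

Section ReducedLagrangian.
Context {R : realType} {m ns nc : nat}.
Variables (fs : 'cV[R]_ns -> R) (fc : 'cV[R]_nc -> R).
Variables (As : 'M[R]_(m, ns)) (Ac : 'M[R]_(m, nc)) (b : 'cV[R]_m).

Definition lagrangian (xs : 'cV[R]_ns) (xc : 'cV[R]_nc) (y : 'cV[R]_m) : R :=
  fs xs + fc xc + (y^T *m (As *m xs + Ac *m xc - b)) ord0 ord0.

Definition lagrangian_minimizer (xc : 'cV[R]_nc) (y : 'cV[R]_m)
    (xs : 'cV[R]_ns) : Prop :=
  forall xs', lagrangian xs xc y <= lagrangian xs' xc y.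

(* The minimum over x_s. The infimum of a set of reals that is unbounded below
   is 0 by convention; this equals the minimum as soon as a
   lagrangian_minimizer exists. *)
Definition reduced_lagrangian (xc : 'cV[R]_nc) (y : 'cV[R]_m) : R :=
  inf (range (fun xs => lagrangian xs xc y)).

Definition saddle_point (z : 'cV[R]_nc * 'cV[R]_m) : Prop :=
  nonneg_vec z.2 /\
  forall (xc : 'cV[R]_nc) (y : 'cV[R]_m), nonneg_vec y ->
    reduced_lagrangian z.1 y <= reduced_lagrangian z.1 z.2 /\
    reduced_lagrangian z.1 z.2 <= reduced_lagrangian xc z.2.

End ReducedLagrangian.

Definition abs_continuous_on (R : realType) (n : nat) (a b : R)
    (f : R -> 'cV[R]_n) : Prop :=
  forall e : R, 0 < e -> exists2 d : R, 0 < d &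
    forall (k : nat) (u v : 'I_k -> R),
      (forall i, [/\ a <= u i, u i <= v i & v i <= b]) ->
      trivIset [set: 'I_k] (fun i => `]u i, v i[%classic) ->
      \sum_(i < k) (v i - u i) < d ->
      \sum_(i < k) enorm (f (v i) - f (u i)) < e.

(* Caratheodory solutions on [0, +oo[ of the reduced primal-dual dynamics. The
   values of xc and y at negative times are irrelevant: the derivatives are
   only taken at t > 0. *)
Definition reduced_pd_solution (R : realType) (m ns nc : nat)
    (fs : 'cV[R]_ns -> R) (fc : 'cV[R]_nc -> R)
    (As : 'M[R]_(m, ns)) (Ac : 'M[R]_(m, nc)) (b : 'cV[R]_m)
    (xc : R -> 'cV[R]_nc) (y : R -> 'cV[R]_m) : Prop :=
  let Lbar := reduced_lagrangian fs fc As Ac b in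
  [/\ forall T : R, 0 <= T ->
        abs_continuous_on 0 T xc /\ abs_continuous_on 0 T y,
      forall t : R, 0 <= t -> nonneg_vec (y t) &
      {ae @lebesgue_measure R, forall t : R, 0 < t ->
         is_derive t 1 xc (- gradient (Lbar ^~ (y t)) (xc t)) /\
         is_derive t 1 y (proj_plus (y t) (gradient (Lbar (xc t)) (y t)))}].

(* Main.v *)
Require Import Defs.
From HB Require Import structures.
From mathcomp Require Import measurable_realfun ring lra.

(** The reduced Lagrangian is [h_s y + f_c x_c + y^T (A_c x_c - b)] with
    [h_s y = min_x (f_s x + y^T A_s x)]. Testing this minimum at the minimizer
    shifted by [- A_s^T d / l_s], the descent lemma for [f_s] gives
    [h_s (y + d) <= h_s y + d^T A_s xbar(y) - |A_s^T d|^2 / (2 l_s)], so [h_s] is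
    [kappa_s / l_s]-strongly concave, while strong convexity of [f_s] gives the
    matching quadratic lower bound, so [A_s xbar(y)] is its gradient. A saddle
    point comes from a maximizer of the strongly concave dual function over the
    nonnegative orthant. The saddle field is strongly monotone with modulus [c]
    and the projection only helps, so [exp(2 c t) |z(t) - z*|^2] has a
    nonpositive derivative almost everywhere; being absolutely continuous, it is
    nonincreasing. *)

(** * Euclidean inner product and norm inequalities *)

Section Euclidean.
Context {R : realType}.

Definition dotv (n : nat) (u v : 'cV[R]_n) : R :=
  \sum_(i < n) u i ord0 * v i ord0.

Lemma dotvE n (u v : 'cV[R]_n) : (u^T *m v) ord0 ord0 = dotv u v.
Proof. by rewrite mxE; apply: eq_bigr => i _; rewrite mxE. Qed.

Lemma dotvC n (u v : 'cV[R]_n) : dotv u v = dotv v u.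
Proof. by apply: eq_bigr => i _; rewrite mulrC. Qed.

Lemma dotvDl n (u v w : 'cV[R]_n) : dotv (u + v) w = dotv u w + dotv v w.
Proof. by rewrite -big_split; apply: eq_bigr => i _; rewrite mxE mulrDl. Qed.

Lemma dotvZl n a (u w : 'cV[R]_n) : dotv (a *: u) w = a * dotv u w.
Proof. by rewrite mulr_sumr; apply: eq_bigr => i _; rewrite mxE mulrA. Qed.

Lemma dotvNl n (u w : 'cV[R]_n) : dotv (- u) w = - dotv u w.
Proof. by rewrite -scaleN1r dotvZl mulN1r. Qed.

Lemma dotvDr n (u v w : 'cV[R]_n) : dotv w (u + v) = dotv w u + dotv w v.
Proof. by rewrite dotvC dotvDl !(dotvC w). Qed.

Lemma dotvZr n a (u w : 'cV[R]_n) : dotv w (a *: u) = a * dotv w u.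
Proof. by rewrite dotvC dotvZl (dotvC w). Qed.

Lemma dotvNr n (u w : 'cV[R]_n) : dotv w (- u) = - dotv w u.
Proof. by rewrite dotvC dotvNl (dotvC w). Qed.

Lemma dotv0l n (w : 'cV[R]_n) : dotv 0 w = 0.
Proof. by rewrite -(scale0r 0) dotvZl mul0r. Qed.

Definition dotv_lin := (dotvDl, dotvDr, dotvZl, dotvZr, dotvNl, dotvNr).

Lemma dotv_mulmx m n (y : 'cV[R]_m) (A : 'M[R]_(m, n)) (x : 'cV[R]_n) :
  dotv y (A *m x) = dotv (A^T *m y) x.
Proof. by rewrite -!dotvE trmx_mul trmxK mulmxA. Qed.

Lemma dotv_col_mx m n (a c : 'cV[R]_m) (b d : 'cV[R]_n) :
  dotv (col_mx a b) (col_mx c d) = dotv a c + dotv b d.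
Proof.
by rewrite -!dotvE tr_col_mx mul_row_col mxE.
Qed.

Lemma dotv_ge0 n (u : 'cV[R]_n) : 0 <= dotv u u.
Proof. by apply: sumr_ge0 => i _; rewrite -expr2 sqr_ge0. Qed.

Lemma dotv_eq0 n (u : 'cV[R]_n) : dotv u u = 0 -> u = 0.
Proof.
move=> u0; apply/colP => i; rewrite mxE; apply/eqP.
rewrite -sqrf_eq0 expr2; apply/eqP.
by apply: (psumr_eq0P _ u0) => // j _; rewrite -expr2 sqr_ge0.
Qed.

Lemma sqr_coord_le_dotv n (u : 'cV[R]_n) i : u i ord0 ^+ 2 <= dotv u u.
Proof.
rewrite /dotv (bigD1 i)//= -expr2 lerDl.
by apply: sumr_ge0 => j _; rewrite -expr2 sqr_ge0.
Qed.

Lemma enorm_sqr n (u : 'cV[R]_n) : enorm u ^+ 2 = dotv u u.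
Proof.
rewrite /enorm sqr_sqrtr; first by apply: eq_bigr => i _; rewrite expr2.
by apply: sumr_ge0 => i _; rewrite sqr_ge0.
Qed.

Lemma enorm_ge0 n (u : 'cV[R]_n) : 0 <= enorm u.
Proof. exact: sqrtr_ge0. Qed.

(** Expand [0 <= |a u - v|^2] and divide by [2 a]. *)
Lemma young_dotv n (a : R) (u v : 'cV[R]_n) : 0 < a ->
  dotv u v <= a / 2 * dotv u u + (2 * a)^-1 * dotv v v.
Proof.
move=> a0; have := dotv_ge0 (a *: u - v); rewrite !dotv_lin (dotvC v u) => h.
rewrite -subr_ge0.
have -> : a / 2 * dotv u u + (2 * a)^-1 * dotv v v - dotv u v =
  (2 * a)^-1 * (a * (a * dotv u u + - dotv u v) + (a * - dotv u v + - - dotv v v)).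
  by field; lra.
by apply: mulr_ge0; [rewrite invr_ge0; lra|lra].
Qed.

Lemma CauchySchwarz_dotv n (u v : 'cV[R]_n) : dotv u v <= enorm u * enorm v.
Proof.
have [u0|u0] := eqVneq (enorm u) 0.
  have -> : u = 0 by apply: dotv_eq0; rewrite -enorm_sqr u0 expr0n.
  by rewrite dotv0l mulr_ge0// enorm_ge0.
have [v0|v0] := eqVneq (enorm v) 0.
  have -> : v = 0 by apply: dotv_eq0; rewrite -enorm_sqr v0 expr0n.
  by rewrite dotvC dotv0l mulr_ge0// enorm_ge0.
have u1 : 0 < enorm u by rewrite lt_def u0 enorm_ge0.
have v1 : 0 < enorm v by rewrite lt_def v0 enorm_ge0.
(* With weight [|v| / |u|], both terms of Young's bound equal [|u| |v| / 2]. *)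
have := young_dotv u v (divr_gt0 v1 u1); rewrite -!enorm_sqr => /le_trans; apply.
by rewrite le_eqVlt; apply/orP; left; apply/eqP; field; rewrite u0 v0.
Qed.

Lemma le_coord_norm m n (M : 'M[R]_(m, n)) i j : `|M i j| <= `|M|.
Proof.
by rewrite [leRHS]/Num.Def.normr/= mx_normrE; apply: (le_bigmax _ _ (i, j)).
Qed.

(** Links the Euclidean product to the sup norm, in which continuity and differentiability are
    expressed. *)
Lemma dotv_le_norm n (u v : 'cV[R]_n) : `|dotv u v| <= n%:R * (`|u| * `|v|).
Proof.
apply: le_trans (ler_norm_sum _ _ _) _.
apply: (@le_trans _ _ (\sum_(i < n) `|u| * `|v|)).
  by apply: ler_sum => i _; rewrite normrM ler_pM// le_coord_norm.
by rewrite sumr_const card_ord -[leLHS]mulr_natl.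
Qed.

End Euclidean.

(** * Gradients, strong convexity and the descent lemma *)

Section Gradients.
Context {R : realType}.

Lemma dotv_is_linear n (u : 'cV[R]_n) : linear (dotv u : 'cV[R]_n -> R).
Proof. by move=> a x y; rewrite !dotv_lin. Qed.

HB.instance Definition _ n (u : 'cV[R]_n) :=
  GRing.isLinear.Build R 'cV[R]_n R _ (dotv u) (dotv_is_linear u).

Lemma continuous_dotv n (u : 'cV[R]_n) : continuous (dotv u).
Proof.
apply/(@linear_bounded_continuous _ _ _ (dotv u))/linear_boundedP.
exists (n%:R * `|u|); rewrite num_real; split=> // r rM x.
apply: le_trans (dotv_le_norm _ _) _.
by rewrite mulrA ler_wpM2r// ltW.
Qed.

Lemma vec_delta n (v : 'cV[R]_n) : v = \sum_(i < n) v i ord0 *: delta_mx i ord0.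
Proof.
apply/colP => j; rewrite summxE (bigD1 j)//= !mxE !eqxx mulr1 big1 ?addr0// => i ij.
by rewrite !mxE eq_sym (negbTE ij) mulr0.
Qed.

Lemma diff_gradient n (f : 'cV[R]_n -> R) x v :
  differentiable f x -> 'd f x v = dotv (gradient f x) v.
Proof.
move=> df; rewrite {1}(vec_delta v) linear_sum; apply: eq_bigr => i _.
by rewrite linearZ/= mxE deriveE// mulrC.
Qed.

Lemma derive_gradient n (f : 'cV[R]_n -> R) x v :
  differentiable f x -> 'D_v f x = dotv (gradient f x) v.
Proof. by move=> df; rewrite deriveE// diff_gradient. Qed.

Lemma is_derive_line n (f : 'cV[R]_n -> R) x v t :
  differentiable f (x + t *: v) ->
  is_derive t 1 (fun s => f (x + s *: v)) (dotv (gradient f (x + t *: v)) v).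
Proof.
move=> df.
have E : (fun h : R => h^-1 *: (f (x + (h *: 1 + t) *: v) - f (x + t *: v))) =
         (fun h : R => h^-1 *: (f (h *: v + (x + t *: v)) - f (x + t *: v))).
  by apply/funext => h; rewrite [h *: 1]mulr1 scalerDl addrCA.
have dv : derivable f (x + t *: v) v by exact: diff_derivable.
apply: DeriveDef; first by rewrite /derivable/= E.
by rewrite -derive_gradient// /derive/= E.
Qed.

(** A quadratic remainder is [o(d)], so uniqueness of the differential identifies it with [dotv g].
    This is how the value function of the inner minimization gets differentiated. *)
Lemma has_gradient_quad n (f : 'cV[R]_n -> R) x g (K : R) :
  (forall d, `|f (x + d) - f x - dotv g d| <= K * `|d| ^+ 2) ->
  has_gradient f x g.
Proof.
move=> fK.
have E : f \o shift x = cst (f x) + (dotv g : 'cV[R]_n -> R^o) +o_ (0 : 'cV[R]_n) id.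
  apply/eqaddoP => e e0; near=> d => /=.
  have -> : (f \o shift x - (cst (f x) + dotv g)) d =
    f (x + d) - f x - dotv g d by rewrite !fctE/= (addrC d) opprD addrA.
  apply: le_trans (fK d) _; rewrite expr2 mulrA ler_wpM2r//.
  apply: le_trans (ler_norm _) _.
  rewrite normrM normr_id -(@ler_pM2r _ (`|K| + 1)^-1) ?invr_gt0 ?ltr_wpDl//.
  rewrite mulrAC; apply: le_trans (_ : `|d| <= _).
    by rewrite ler_piMl// ler_pdivrMr ?ltr_wpDl// mul1r lerDl.
  near: d; apply: cvgr0_norm_le; first exact: cvg_id.
  by rewrite divr_gt0// ltr_wpDl.
have E' := diff_unique (@continuous_dotv _ g) E.
have df : differentiable f x.
  apply/diff_locallyP; split; first by rewrite E'; exact: continuous_dotv.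
  by rewrite E'.
split=> //; apply/colP => i; rewrite mxE deriveE// E'.
change (dotv g (delta_mx i ord0) = g i ord0).
rewrite /dotv (bigD1 i)//= mxE !eqxx mulr1 big1 ?addr0// => j ij.
by rewrite mxE (negbTE ij) mulr0.
Unshelve. all: by end_near. Qed.

Lemma has_gradientD n (f g : 'cV[R]_n -> R) x u v :
  has_gradient f x u -> has_gradient g x v ->
  has_gradient (fun z => f z + g z) x (u + v).
Proof.
move=> [df fu] [dg gv]; split; first exact: differentiableD.
apply/colP => i; rewrite !mxE -fu -gv !mxE.
by rewrite (@deriveD _ _ _ f g)//; exact: diff_derivable.
Qed.

Lemma has_gradient_affine n (u : 'cV[R]_n) (a : R) x :
  has_gradient (fun z => dotv u z + a) x u.
Proof.
apply: (@has_gradient_quad _ _ _ _ 0) => d.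
rewrite mul0r dotvDr.
by rewrite (_ : _ - _ = 0) ?normr0//; ring.
Qed.

(** Divide by [t] and let [t] tend to 0 from the right: the term [t * b] disappears in the limit. *)
Lemma dotv_gradient_le n (f : 'cV[R]_n -> R) x d (a b : R) :
  differentiable f x ->
  (forall t, 0 < t -> t <= 1 -> f (x + t *: d) - f x <= t * (a + t * b)) ->
  dotv (gradient f x) d <= a.
Proof.
move=> df ub; have cd : derivable f x d by exact: diff_derivable.
rewrite /derivable/= in cd.
have := @derive_gradient _ _ _ d df; rewrite /derive/= => dE.
rewrite -dE; apply/ler_addgt0Pr => e e0.
apply: cvgr_to_le (cvg_dnbhs_at_right cd) _; near=> t.
have t0 : 0 < t by near: t; exact: nbhs_right_gt.
have t1 : t <= 1 by near: t; exact: nbhs_right_le.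
rewrite [_ *: _]/(_ * _) ler_pdivrMl// [_ + x]addrC.
apply: le_trans (ub t t0 t1) _; rewrite ler_pM2l// lerD2l.
have b1 : 0 < `|b| + 1 by rewrite ltr_wpDl.
have : t * (`|b| + 1) <= e.
  rewrite -ler_pdivlMr//; near: t; apply: nbhs_right_le.
  by rewrite divr_gt0.
apply: le_trans; rewrite ler_pM2l//.
by apply: le_trans (ler_norm _) _; rewrite lerDl.
Unshelve. all: by end_near. Qed.

Lemma has_gradientN n (f : 'cV[R]_n -> R) x u :
  has_gradient f x u -> has_gradient (fun z => - f z) x (- u).
Proof.
move=> [df fu]; split; first exact: differentiableN.
apply/colP => i; rewrite !mxE -fu !mxE.
by rewrite (@deriveN _ _ _ f)//; exact: diff_derivable.
Qed.

Lemma dotv_gradient_ge0 n (f : 'cV[R]_n -> R) x d :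
  differentiable f x ->
  (forall t, 0 < t -> t <= 1 -> f x <= f (x + t *: d)) ->
  0 <= dotv (gradient f x) d.
Proof.
move=> df fx; have [dN gN] : has_gradient (fun z => - f z) x (- gradient f x).
  exact: has_gradientN.
rewrite -oppr_le0 -dotvNl -gN.
apply: (@dotv_gradient_le _ _ _ _ 0 0) => // t t0 t1.
by rewrite mulr0 addr0 mulr0 opprK addrC subr_le0; exact: fx.
Qed.

(** Strong convexity between [x + d] and [x] bounds the increment over [t *: d] by [t * (a + t * b)]
    with [b = mu / 2 * |d|^2] and [a = f (x + d) - f x - b]; the limit in [t] gives the tangent
    inequality. *)
Lemma strongly_convex_gradient n mu (f : 'cV[R]_n -> R) x d :
  strongly_convex mu f -> differentiable f x ->
  f x + dotv (gradient f x) d + mu / 2 * dotv d d <= f (x + d).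
Proof.
move=> sc df.
suff : dotv (gradient f x) d <= f (x + d) - f x - mu / 2 * dotv d d by lra.
apply: (@dotv_gradient_le _ _ _ _ _ (mu / 2 * dotv d d)) => // t t0 t1.
have := sc (x + d) x t (ltW t0) t1.
rewrite (_ : t *: (x + d) + (1 - t) *: x = x + t *: d); last first.
  by rewrite scalerDr scalerBl scale1r addrC addrA subrK.
by rewrite [x + d]addrC addrK enorm_sqr addrC; lra.
Qed.

Lemma lipschitz_gradient_descent n l (f : 'cV[R]_n -> R) x d :
  (forall z, differentiable f z) -> 0 < l -> lipschitz_gradient l f ->
  f (x + d) <= f x + dotv (gradient f x) d + l / 2 * dotv d d.
Proof.
move=> df l0 lip.
(* [phi] is [f] along the segment minus the claimed upper model, up to the constant [f x].
   Cauchy-Schwarz and the Lipschitz bound make its derivative nonpositive, which replaces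
   integration of the gradient. *)
pose phi (t : R) := f (x + t *: d) - (t * dotv (gradient f x) d + t ^+ 2 * (l / 2 * dotv d d)).
have dphi (t : R) : is_derive t 1 phi (dotv (gradient f (x + t *: d)) d -
   (dotv (gradient f x) d + t * l * dotv d d)).
  have := is_derive_line (df (x + t *: d)) => ?.
  apply: is_derive_eq.
  by rewrite /=; congr (_ - _); rewrite /GRing.scale/=; field.
have : phi 1 <= phi 0.
  apply: (@ler0_derive1_nincr _ phi 0 1) => //.
  - move=> t; rewrite in_itv/= => /andP[t0 _].
    rewrite derive1E (@derive_val _ _ _ _ _ _ _ (dphi t)).
    have -> : dotv (gradient f (x + t *: d)) d -
     (dotv (gradient f x) d + t * l * dotv d d) =
     dotv (gradient f (x + t *: d) - gradient f x) d - t * l * dotv d d.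
      by rewrite !dotv_lin; ring.
    rewrite subr_le0 (le_trans (CauchySchwarz_dotv _ _))//.
    rewrite -enorm_sqr expr2 mulrA ler_wpM2r ?enorm_ge0//.
    have := lip (x + t *: d) x; rewrite [x + _]addrC addrK => /le_trans; apply.
    have -> : enorm (t *: d) = t * enorm d.
      apply/eqP; rewrite -(@eqrXn2 _ 2)// ?enorm_ge0//.
        by rewrite exprMn !enorm_sqr !dotv_lin; apply/eqP; ring.
      by rewrite mulr_ge0 ?enorm_ge0// ltW.
    by rewrite mulrCA mulrA.
  - by apply: derivable_within_continuous => t _; case: (dphi t).
rewrite /phi scale0r addr0 scale1r expr0n/= expr1n !mul0r !mul1r; lra.
Qed.

End Gradients.

(** * Existence of minimizers by coercivity *)

Section Minimization.
Context {R : realType}.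

Lemma continuous_trmx m n : continuous (@trmx R m n).
Proof.
move=> M s /= /(nbhs_ballP (M^T)) [e e0 es].
apply/(nbhs_ballP M); exists e => //= N [_ MN].
by apply: es; split=> // i j; rewrite !mxE; exact: MN.
Qed.

(** Heine-Borel for row vectors, carried over to columns by the continuous map [trmx]. *)
Lemma cV_bounded_closed_compact n (A : set 'cV[R]_n) (M : R) :
  (forall x i, A x -> `|x i ord0| <= M) -> closed A -> compact A.
Proof.
move=> AM cA.
have -> : A = trmx @` ((@trmx R 1 n) @^-1` A).
  apply/seteqP; split=> [x Ax|x [y Ay <-]//]; exists x^T; last exact: trmxK.
  by rewrite /= trmxK.
apply: continuous_compact.
  by apply: continuous_subspaceT; exact: continuous_trmx.
apply: bounded_closed_compact; last first.
  by apply: preimage_closed => // x _; exact: continuous_trmx.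
exists `|M|; split; first by rewrite num_real.
move=> r Mr x /= Ax; rewrite [leLHS]/Num.Def.normr/= mx_normrE.
apply: bigmax_le => [|[i j] _ /=].
  by apply: le_trans (ltW Mr); exact: normr_ge0.
have := AM _ j Ax; rewrite mxE (ord1 i) => /le_trans; apply.
by apply: le_trans (ltW Mr); exact: ler_norm.
Qed.

(** The quadratic minorant bounds the sublevel set of [g x0] in [D], which is therefore compact; a
    minimizer there is a minimizer on all of [D]. *)
Lemma exists_min_coercive n (D : set 'cV[R]_n) (g : 'cV[R]_n -> R)
    (g0 mu : R) (p : 'cV[R]_n) :
  D !=set0 -> closed D -> continuous g -> 0 < mu ->
  (forall x, D x -> g0 + dotv p x + mu / 2 * dotv x x <= g x) ->
  exists2 x, D x & forall x', D x' -> g x <= g x'.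
Proof.
move=> [x0 Dx0] cD cg mu0 gp.
pose K := D `&` [set x | g x <= g x0].
have cK : closed K.
  apply: closedI => //.
  apply: (@preimage_closed _ _ g [set r | r <= g x0]); last exact: closed_le.
  by move=> x _; exact: cg.
(* [C] bounds [|x|^2] on [K]: Young with weight [2 / mu] absorbs the linear term into half of the
   quadratic one, leaving [mu / 4 * |x|^2]. *)
pose C := 4 / mu * (g x0 - g0 + mu^-1 * dotv p p).
have KC x i : K x -> `|x i ord0| <= C + 1.
  move=> [Dx gx]; have := le_trans (gp x Dx) gx => gpx.
  have ia : 0 < 2 / mu by rewrite divr_gt0.
  have := young_dotv (- p) x ia; rewrite !dotv_lin => yp.
  have E1 : 2 / mu / 2 = mu^-1 by field; lra.
  have E2 : (2 * (2 / mu))^-1 = mu / 4 by field; lra.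
  rewrite E1 E2 in yp.
  have xx : dotv x x <= C.
    rewrite /C mulrAC -ler_pdivrMr ?invr_gt0//.
    lra.
  (* From [r ^+ 2 <= C] follows [r <= C + 1], a bound free of square roots. *)
  have := sqr_coord_le_dotv x i; rewrite -real_normK ?num_real// => xi.
  have := le_trans xi xx; have := normr_ge0 (x i ord0).
  set r := `|_|; nra.
have cptK := cV_bounded_closed_compact KC cK.
have [|x|x /set_mem[Dx _] xmin] := @compact_EVT_min _ R g K _ cptK.
- by exists x0; split=> //=.
- by apply: continuous_subspaceT.
exists x => // y Dy; have [gy|/ltW gy] := leP (g y) (g x0).
  by apply: xmin; rewrite inE.
by apply: le_trans gy; apply: xmin; rewrite inE; split => //=.
Qed.

End Minimization.

(** * The minimum over [x] of [f x + y^T A x] as a function of [y] *)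

Section InnerMinimum.
Context {R : realType} (m n : nat).
Variables (f : 'cV[R]_n -> R) (A : 'M[R]_(m, n)) (mu : R).
Hypothesis mu0 : 0 < mu.
Hypothesis df : forall x, differentiable f x.
Hypothesis sc : strongly_convex mu f.

Definition inner_obj (y : 'cV[R]_m) (x : 'cV[R]_n) := f x + dotv y (A *m x).

Lemma inner_objE y x : inner_obj y x = f x + dotv (A^T *m y) x.
Proof. by rewrite /inner_obj dotv_mulmx. Qed.

Lemma exists_inner_argmin y : exists x, forall x', inner_obj y x <= inner_obj y x'.
Proof.
have [|||//||x _ xmin] := @exists_min_coercive R n setT (inner_obj y)
   (f 0) mu (gradient f 0 + A^T *m y).
- by exists 0.
- exact: closedT.
- move=> x; apply: differentiable_continuous.
  rewrite (_ : inner_obj y = (fun x => f x + (dotv (A^T *m y) x + 0))).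
    by apply: differentiableD => //; case: (@has_gradient_affine R n (A^T *m y) 0 x).
  by apply/funext => z; rewrite inner_objE addr0.
- move=> x _; rewrite inner_objE dotv_lin.
  by have := strongly_convex_gradient x sc (df 0); rewrite add0r; lra.
by exists x => x'; exact: xmin.
Qed.

Definition argmin y : 'cV[R]_n := sval (cid (exists_inner_argmin y)).

Lemma argminP y x : inner_obj y (argmin y) <= inner_obj y x.
Proof. exact: svalP (cid (exists_inner_argmin y)) x. Qed.

Lemma gradient_argmin y : gradient f (argmin y) = - (A^T *m y).
Proof.
set g := A^T *m y; set x := argmin y.
apply/eqP; rewrite -addr_eq0; apply/eqP/dotv_eq0/eqP; rewrite eq_le dotv_ge0 andbT.
set v := gradient f x + g.
have [dF gF] : has_gradient (fun z => f z + (dotv g z + 0)) x v.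
  by apply: has_gradientD; [|exact: has_gradient_affine].
(* Testing minimality in the direction [- v], where [v] is the gradient of the objective, gives
   [- |v|^2 >= 0]. *)
rewrite -oppr_ge0 -dotvNr -{1}gF; apply: dotv_gradient_ge0 => // t _ _.
by rewrite !addr0 -!inner_objE; exact: argminP.
Qed.

(** The tangent inequality at [argmin y] loses its linear part, because the gradient of the whole
    objective vanishes there. *)
Lemma argmin_quad y x :
  inner_obj y (argmin y) + mu / 2 * dotv (x - argmin y) (x - argmin y) <= inner_obj y x.
Proof.
have := strongly_convex_gradient (x - argmin y) sc (df (argmin y)).
rewrite gradient_argmin (addrC (argmin y)) subrK !inner_objE dotvNl dotvDr dotvNr; lra.
Qed.

Lemma argmin_unique y x :
  (forall x', inner_obj y x <= inner_obj y x') <-> x = argmin y.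
Proof.
split=> [xmin|->]; last exact: argminP.
apply/subr0_eq/dotv_eq0/eqP; rewrite eq_le dotv_ge0 andbT.
rewrite -(pmulr_rle0 _ (_ : 0 < mu / 2)) ?divr_gt0//.
have := argmin_quad y x; have := xmin (argmin y); lra.
Qed.

Definition inner_min y := inner_obj y (argmin y).

(** The old minimizer is a competitor for [y + d], so [A *m argmin y] is a supergradient. *)
Lemma inner_min_le_affine y d :
  inner_min (y + d) <= inner_min y + dotv d (A *m argmin y).
Proof.
by apply: le_trans (argminP _ (argmin y)) _; rewrite /inner_min /inner_obj dotvDl addrA.
Qed.

(** Quadratic growth at [argmin y], evaluated at the new minimizer, pays for the displacement of the
    minimizer: Young with weight [mu^-1] splits its product with [A^T d]. *)
Lemma inner_min_ge_quad y d :
  inner_min y + dotv d (A *m argmin y) - (2 * mu)^-1 * dotv (A^T *m d) (A^T *m d)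
    <= inner_min (y + d).
Proof.
have := argmin_quad y (argmin (y + d)).
have := young_dotv (- (A^T *m d)) (argmin (y + d) - argmin y) (_ : 0 < mu^-1).
rewrite invr_gt0 => /(_ mu0).
rewrite /inner_min {3}/inner_obj !inner_objE mulmxDr !dotv_lin.
rewrite !(dotv_mulmx _ A).
have -> : mu^-1 / 2 = (2 * mu)^-1 by field; rewrite gt_eqF.
have -> : (2 * mu^-1)^-1 = mu / 2 by field; rewrite gt_eqF.
lra.
Qed.

(** The affine upper bound and the quadratic lower bound squeeze the first-order remainder, which is
    thus quadratic in [d]. *)
Lemma inner_min_gradient y : has_gradient inner_min y (A *m argmin y).
Proof.
apply: (@has_gradient_quad _ _ _ _ _
  ((2 * mu)^-1 * (n%:R * (m%:R * `|A|) ^+ 2))) => d.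
(* In sup norms, each of the [n] entries of [A^T d] is a sum of [m] products, hence at most
   [m |A| |d|]. *)
have Ad : dotv (A^T *m d) (A^T *m d) <= n%:R * ((m%:R * `|A|) ^+ 2 * `|d| ^+ 2).
  apply: le_trans (ler_norm _) _; apply: le_trans (dotv_le_norm _ _) _.
  rewrite ler_wpM2l// -expr2 -exprMn lerXn2r// ?nnegrE ?mulr_ge0//.
  rewrite [leLHS]/Num.Def.normr/= mx_normrE bigmax_le ?mulr_ge0// => -[i j] _ /=.
  rewrite mxE; apply: le_trans (ler_norm_sum _ _ _) _.
  apply: (@le_trans _ _ (\sum_(k < m) `|A| * `|d|)).
    by apply: ler_sum => k _; rewrite mxE normrM ler_pM// le_coord_norm.
  by rewrite sumr_const card_ord -[leLHS]mulr_natl mulrA.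
have m2 : 0 < (2 * mu)^-1 by rewrite invr_gt0 mulr_gt0.
have := inner_min_le_affine y d; have := inner_min_ge_quad y d.
rewrite -(ler_pM2l m2) in Ad.
rewrite ler_norml (dotvC _ d).
have <- : (2 * mu)^-1 * (n%:R * ((m%:R * `|A|) ^+ 2 * `|d| ^+ 2)) =
    (2 * mu)^-1 * (n%:R * (m%:R * `|A|) ^+ 2) * `|d| ^+ 2 by rewrite !mulrA.
set q := (2 * mu)^-1 * dotv _ _ in Ad *; set p := (2 * mu)^-1 * _ in Ad *.
have q0 : 0 <= q by rewrite mulr_ge0 ?dotv_ge0// ltW.
by move=> h1 h2; apply/andP; split; lra.
Qed.

Lemma inner_min_le_quad l y d : 0 < l -> lipschitz_gradient l f ->
  inner_min (y + d) <= inner_min y + dotv d (A *m argmin y)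
     - (2 * l)^-1 * dotv (A^T *m d) (A^T *m d).
Proof.
(* This [e] minimizes the model [dotv (A^T *m d) e + l / 2 * |e|^2] left by the descent lemma once
   the stationarity of [argmin y] has cancelled the other linear terms in [e]. *)
move=> l0 lip; set e := - l^-1 *: (A^T *m d).
apply: le_trans (argminP _ (argmin y + e)) _.
have := lipschitz_gradient_descent (argmin y) e df l0 lip.
rewrite gradient_argmin /inner_min !inner_objE mulmxDr dotv_mulmx /e !dotv_lin.
set dd := dotv (A^T *m d) (A^T *m d).
have -> : l / 2 * (- l^-1 * (- l^-1 * dd)) = (2 * l)^-1 * dd by field; lra.
have -> : - l^-1 * dd = - (2 * ((2 * l)^-1 * dd)) by field; lra.
lra.
Qed.

End InnerMinimum.

(** * Monotonicity from the sign of an almost everywhere derivative *)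

Section AbsolutelyContinuous.
Context {R : realType}.

(** Additivity turns the sum into the measure of the union, which lies in [U]; a degenerate interval
    is empty and counts zero on both sides. *)
Lemma sum_length_le_measure (k : nat) (u v : nat -> R) (U : set R) :
  measurable U ->
  (forall i, (i < k)%N -> u i <= v i /\ `]u i, v i[ `<=` U) ->
  trivIset [set: 'I_k] (fun i => `]u i, v i[%classic) ->
  ((\sum_(i < k) (v i - u i))%:E <= lebesgue_measure U)%E.
Proof.
move=> mU uv tuv.
have -> : (\sum_(i < k) (v i - u i))%:E =
    (\sum_(i < k) lebesgue_measure (`]u i, v i[%classic : set R))%E.
  rewrite -sumEFin; apply: eq_bigr => i _.
  rewrite lebesgue_measure_itv/= lte_fin; case: ltP => // vu.
  have [uv' _] := uv i (ltn_ord i).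
  by have -> : v i = u i; [lra|rewrite subrr].
rewrite -(@measure_bigsetU_ord _ _ _ lebesgue_measure _ xpredT)//.
apply: le_measure; rewrite ?inE//.
  by apply: bigsetU_measurable => i _; exact: measurable_itv.
rewrite -bigcup_seq => x [i _]; exact: (uv i (ltn_ord i)).2.
Qed.

(** A straddle estimate: close to [s] the difference quotients at [s] stay below [e] on either side,
    and the increments over [[t, s]] and [[s, t']] add up. *)
Lemma derive1_le0_increment (W : R -> R) (s e : R) : 0 < e ->
  derivable W s 1 -> 'D_1 W s <= 0 ->
  exists2 r : R, 0 < r & forall t t', s - r < t -> t <= s -> s <= t' -> t' < s + r ->
    W t' - W t <= e * (t' - t).
Proof.
move=> e0 dW W0.
have : \forall h \near 0^', h^-1 *: (W (h *: 1 + s) - W s) < e.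
  by apply: (cvgr_lt _ dW); exact: le_lt_trans W0 _.
move=> -[r /= r0 rW]; exists r => // t t' st ts st' t's.
have up h : 0 <= h -> h < r -> W (h + s) - W s <= e * h.
  rewrite le_eqVlt => /predU1P[<-|h0] hr; first by rewrite add0r subrr mulr0.
  have := rW h; rewrite /ball_/= sub0r normrN gtr0_norm// => /(_ hr).
  rewrite gt_eqF// => /(_ isT); rewrite [h *: 1]mulr1 [_ *: _]/(_ * _).
  by rewrite ltr_pdivrMl// mulrC => /ltW.
have dn h : 0 <= h -> h < r -> W s - W (s - h) <= e * h.
  rewrite le_eqVlt => /predU1P[<-|h0] hr; first by rewrite subr0 subrr mulr0.
  have := rW (- h); rewrite /ball_/= sub0r normrN normrN gtr0_norm// => /(_ hr).
  rewrite oppr_eq0 gt_eqF// => /(_ isT); rewrite /GRing.scale/= mulr1.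
  have -> : (- h)^-1 * (W (- h + s) - W s) = h^-1 * (W s - W (- h + s)).
    by field; rewrite gt_eqF.
  by rewrite ltr_pdivrMl// mulrC => /ltW; rewrite (addrC (- h)).
have := up (t' - s); have := dn (s - t); rewrite subrK subKr.
by move=> H1 H2; have := H1 _ _; have := H2 _ _; lra.
Qed.

(* Cover the exceptional null set by an open [U] shorter than the modulus of
   absolute continuity for [e]. By a supremum argument, [W b - W a] is at most
   [e * (b - a)] plus the increments of [W] over finitely many disjoint
   intervals of [U], whose total is less than [e]. *)
Lemma abs_cont_ae_derive_le0 (a b : R) (W : R -> R) : a <= b ->
  (forall e : R, 0 < e -> exists2 d : R, 0 < d &
    forall (k : nat) (u v : 'I_k -> R),
      (forall i, [/\ a <= u i, u i <= v i & v i <= b]) ->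
      trivIset [set: 'I_k] (fun i => `]u i, v i[%classic) ->
      \sum_(i < k) (v i - u i) < d ->
      \sum_(i < k) (W (v i) - W (u i)) < e) ->
  {ae @lebesgue_measure R, forall t, a < t -> t < b ->
     derivable W t 1 /\ 'D_1 W t <= 0} ->
  W b <= W a.
Proof.
move=> ab acW [N [mN N0 dWN]].
suff H e : 0 < e -> W b - W a <= e * (b - a) + e.
  rewrite -subr_le0; apply/ler_addgt0Pr => e e0; rewrite add0r.
  have ba1 : 0 < b - a + 1 by lra.
  apply: le_trans (H (e / (b - a + 1)) _) _; first by rewrite divr_gt0.
  by rewrite -[X in _ + X]mulr1 -mulrDr divfK// gt_eqF.
move=> e0; have [d d0 acWd] := acW e e0.
(* The endpoints join the exceptional set, since the derivative is controlled only strictly between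
   them. *)
have mab : measurable ([set a; b] : set R).
  by apply: measurableU; exact: measurable_set1.
have mN' : measurable (N `|` [set a; b]) by exact: measurableU.
have N'0 : lebesgue_measure (N `|` [set a; b]) = 0%E.
  rewrite (measureU0 mN mab)//; apply: countable_lebesgue_measure0.
  exact/finite_set_countable/finite_set2.
have [U [oU NU Ud]] := @lebesgue_regularity_outer R (N `|` [set a; b]) d mN'
  (eq_ind_r (fun x => (x < +oo)%E) (ltry _) N'0) d0.
have mU : measurable U by exact: open_measurable.
have muU : (lebesgue_measure U < d%:E)%E.
  have mD := measurableD mU mN'.
  have UD : (lebesgue_measure U <= lebesgue_measure (U `\` (N `|` [set a; b]))
      + lebesgue_measure (N `|` [set a; b]))%E.
    apply: le_trans (measureU2 lebesgue_measure mD mN').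
    apply: le_measure; rewrite ?inE//; first exact: measurableU.
    by move=> x Ux; have [|] := pselect ((N `|` [set a; b]) x); [right|left].
  by rewrite N'0 adde0 in UD; exact: le_lt_trans UD Ud.
(* [P t] says that the estimate has been carried from [a] to [t]. Intervals are listed from left to
   right, indexed by [nat], so that one more can be appended. *)
pose P t := exists k (u v : nat -> R),
  [/\ forall i, (i < k)%N -> [/\ a <= u i, u i <= v i & v i <= t],
      forall i j, (i < j)%N -> (j < k)%N -> v i <= u j,
      forall i, (i < k)%N -> `]u i, v i[ `<=` U &
      W t - W a <= e * (t - a) + \sum_(i < k) (W (v i) - W (u i))].
(* [P] propagates across every point [s]. If [s] is in [U], the interval []t, t'[] joins the list;
   otherwise [s] is a good point and the straddle estimate accounts for the increment. *)
have step s : a <= s -> s <= b -> exists2 r, 0 < r &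
    forall t t', a <= t -> s - r < t -> t <= s -> s <= t' -> t' < s + r -> t' <= b ->
      P t -> P t'.
  move=> as_ sb; have [sU|sU] := pselect (U s).
    have /nbhs_ballP[r /= r0 rU] : nbhs s U by exact: open_nbhs_nbhs.
    exists r => // t t' at_ rt ts st' rt' t'b [k [u [v [uv dis uvU Wt]]]].
    exists k.+1, (fun i => if (i < k)%N then u i else t),
      (fun i => if (i < k)%N then v i else t'); split.
    - move=> i _; case: ifP => [/uv[]? ? ?|_]; split => //; lra.
    - move=> i j ij; rewrite ltnS => jk.
      rewrite (leq_trans ij jk); case: ifP => [jk'|_]; first exact: dis.
      by have [] := uv i (leq_trans ij jk).
    - move=> i _; case: ifP => [/uvU//|_] x; rewrite /= in_itv/= => /andP[tx xt].
      by apply: rU; rewrite /ball/= ltr_norml; lra.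
    - rewrite big_ord_recr/= ltnn.
      rewrite (eq_bigr (fun i : 'I_k => W (v i) - W (u i))); last first.
        by move=> i _; rewrite ltn_ord.
      have : 0 <= e * (t' - t) by rewrite mulr_ge0//; lra.
      lra.
  have [sa sb'] : s != a /\ s != b.
    by split; apply/eqP => sE; apply: sU; apply: NU; right; rewrite sE; [left|right].
  have [] : derivable W s 1 /\ 'D_1 W s <= 0.
    apply: contrapT => ns; apply: sU; apply: NU; left; apply: dWN => /= dW.
    by apply: ns; apply: dW; rewrite lt_neqAle ?as_ ?sb ?sb' // eq_sym sa.
  move=> dW W0; have [r r0 rW] := derive1_le0_increment e0 dW W0.
  exists r => // t t' at_ rt ts st' rt' t'b [k [u [v [uv dis uvU Wt]]]].
  exists k, u, v; split=> //.
    by move=> i /uv[? ? ?]; split=> //; lra.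
  have := rW t t' rt ts st' rt'; lra.
have Pa : P a.
  by exists 0%N, (fun=> 0), (fun=> 0); split=> //; rewrite big_ord0 !subrr mulr0 addr0.
have Pb : P b.
  (* A point of [S] within [r] of [sup S] lets [P] propagate to [sup S + r / 2], contradicting the
     supremum, unless [b] is reached first. *)
  pose S := [set t | [/\ a <= t, t <= b & P t]].
  have Sa : S a by split.
  have hS : has_sup S by split; [exists a|exists b => t []].
  have as_ : a <= sup S by apply: ub_le_sup => //; exact: hS.2.
  have sb : sup S <= b by apply: ge_sup; [exists a|move=> t []].
  have [r r0 rP] := step _ as_ sb.
  have [t [at_ tb Pt] st] := sup_adherent r0 hS.
  have ts : t <= sup S by apply: ub_le_sup => //; exact: hS.2.
  have [sr|/ltW sr] := leP (sup S + r / 2) b.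
    have : sup S + r / 2 <= sup S.
      apply: ub_le_sup; first exact: hS.2.
      by split=> //; [lra|apply: (rP t) => //; lra].
    by lra.
  by apply: (rP t) => //; lra.
have [k [u [v [uv dis uvU Wb]]]] := Pb.
have tuv : trivIset [set: 'I_k] (fun i => `]u i, v i[%classic).
  apply/trivIsetP => i j _ _ ij; rewrite -subset0 => x [/=].
  rewrite !in_itv/= => /andP[u1 v1] /andP[u2 v2].
  have [ij'|ji|/val_inj ij'] := ltngtP i j.
  - by have := dis i j ij' (ltn_ord j); lra.
  - by have := dis j i ji (ltn_ord i); lra.
  - by rewrite ij' eqxx in ij.
have len : \sum_(i < k) (v i - u i) < d.
  rewrite -lte_fin; apply: le_lt_trans muU.
  apply: sum_length_le_measure => // i ik; split; last exact: uvU.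
  by have [] := uv i ik.
have := acWd k u v (fun i => uv i (ltn_ord i)) tuv len.
lra.
Qed.
End AbsolutelyContinuous.

(** * Exponential decay along absolutely continuous curves *)

Section Decay.
Context {R : realType}.

Lemma is_derive_coord m n (M : R -> 'M[R]_(m, n)) (t : R) (dM : 'M[R]_(m, n)) i j :
  is_derive t 1 M dM -> is_derive t 1 (fun s => M s i j) (dM i j).
Proof.
move=> [dv <-]; apply: DeriveDef; first exact: (derivable_mxP M t 1).1.
by rewrite derive_mx// mxE.
Qed.

Lemma is_derive_col_mx m n (x : R -> 'cV[R]_m) (y : R -> 'cV[R]_n) (t : R)
    (dx : 'cV[R]_m) (dy : 'cV[R]_n) :
  is_derive t 1 x dx -> is_derive t 1 y dy ->
  is_derive t 1 (fun s => col_mx (x s) (y s)) (col_mx dx dy).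
Proof.
move=> Dx Dy.
have dxy i j : is_derive t 1 (fun s => col_mx (x s) (y s) i j) (col_mx dx dy i j).
  case: (split_ordP i) => k ->.
    rewrite col_mxEu (_ : (fun s => _) = (fun s => x s k j)).
      exact: is_derive_coord.
    by apply/funext => s; rewrite col_mxEu.
  rewrite col_mxEd (_ : (fun s => _) = (fun s => y s k j)).
    exact: is_derive_coord.
  by apply/funext => s; rewrite col_mxEd.
have dv : derivable (fun s => col_mx (x s) (y s)) t 1.
  by apply/derivable_mxP => i j; case: (dxy i j).
apply: DeriveDef => //; rewrite derive_mx//.
by apply/matrixP => i j; rewrite [LHS]mxE; case: (dxy i j).
Qed.

Lemma is_derive_sqr_dist n (z : R -> 'cV[R]_n) (z0 : 'cV[R]_n) (t : R) (dz : 'cV[R]_n) :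
  is_derive t 1 z dz ->
  is_derive t 1 (fun s => dotv (z s - z0) (z s - z0)) (2 * dotv (z t - z0) dz).
Proof.
move=> Dz.
pose h (i : 'I_n) (s : R) := (z s i ord0 - z0 i ord0) * (z s i ord0 - z0 i ord0).
have Dh i : is_derive t 1 (h i) (2 * ((z t - z0) i ord0 * dz i ord0)).
  have Di := is_derive_coord i ord0 Dz.
  by apply: is_derive_eq; rewrite !mxE /GRing.scale/=; ring.
rewrite (_ : (fun s => _) = \sum_(i < n) h i).
  by apply: is_derive_eq; rewrite mulr_sumr.
by apply/funext => s; rewrite fct_sumE; apply: eq_bigr => i _; rewrite !mxE.
Qed.

Lemma norm_le_enorm n (x : 'cV[R]_n) : `|x| <= enorm x.
Proof.
rewrite [leLHS]/Num.Def.normr/= mx_normrE.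
apply: bigmax_le => [|[i j] _ /=]; first exact: enorm_ge0.
rewrite (ord1 j) -(@ler_pXn2r _ 2)// ?nnegrE ?enorm_ge0//.
by rewrite real_normK ?num_real// enorm_sqr sqr_coord_le_dotv.
Qed.

Lemma abs_continuous_on_increment n (a b : R) (z : R -> 'cV[R]_n) :
  abs_continuous_on a b z -> forall e, 0 < e -> exists2 d, 0 < d &
    forall u v, a <= u -> u <= v -> v <= b -> v - u < d -> enorm (z v - z u) < e.
Proof.
move=> acz e e0; have [d d0 zd] := acz e e0; exists d => // u v au uv vb uvd.
have := zd 1%N (fun=> u) (fun=> v).
rewrite !big_ord1; apply => //.
by apply/trivIsetP => i j; rewrite !ord1 eqxx.
Qed.

Lemma abs_continuous_on_bounded n (a b : R) (z : R -> 'cV[R]_n) :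
  a <= b -> abs_continuous_on a b z ->
  exists M, forall t, a <= t -> t <= b -> `|z t| <= M.
Proof.
move=> ab /abs_continuous_on_increment acz.
have cz : {within `[a, b], continuous (fun t => `|z t|)}.
  apply/subspace_continuousP => t /=; rewrite in_itv/= => /andP[at_ tb].
  apply: cvg_norm.
  apply/cvgrPdist_lt => e e0; have [d d0 zd] := acz e e0.
  near=> s.
  have : `[a, b]%classic s.
    by near: s; exact: withinT.
  rewrite /= in_itv/= => /andP[as_ sb].
  apply: le_lt_trans (norm_le_enorm _) _.
  have : `|t - s| < d.
    by near: s; apply: cvg_within; exact: (nbhsx_ballx t d d0).
  rewrite ltr_norml => /andP[h1 h2].
  have [ts|st] := leP t s.
    rewrite -(opprB (z s)); have -> : enorm (- (z s - z t)) = enorm (z s - z t).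
      by apply/eqP; rewrite -(@eqrXn2 _ 2)// ?enorm_ge0// !enorm_sqr dotvNl dotvNr opprK.
    by apply: zd => //; lra.
  by apply: zd => //; lra.
have [c _ cM] := @EVT_max R _ a b ab cz.
by exists `|z c| => t at_ tb; apply: cM; rewrite in_itv/= at_ tb.
Unshelve. all: by end_near. Qed.

(** Each block gets half of [e], because the norm of a stacked vector is at most the sum of the
    norms of its blocks. *)
Lemma abs_continuous_on_col_mx m n (a b : R) (x : R -> 'cV[R]_m) (y : R -> 'cV[R]_n) :
  abs_continuous_on a b x -> abs_continuous_on a b y ->
  abs_continuous_on a b (fun t => col_mx (x t) (y t)).
Proof.
move=> acx acy e e0; have e2 : 0 < e / 2 by rewrite divr_gt0.
have [d1 d10 xd] := acx _ e2; have [d2 d20 yd] := acy _ e2.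
exists (Num.min d1 d2) => [|k u v uv tuv]; first by rewrite lt_min d10.
rewrite lt_min => /andP[l1 l2].
have := xd k u v uv tuv l1; have := yd k u v uv tuv l2.
have : \sum_(i < k) enorm (col_mx (x (v i)) (y (v i)) - col_mx (x (u i)) (y (u i)))
  <= \sum_(i < k) enorm (x (v i) - x (u i)) + \sum_(i < k) enorm (y (v i) - y (u i)).
  rewrite -big_split; apply: ler_sum => i _ /=.
  rewrite opp_col_mx add_col_mx.
  rewrite -(@ler_pXn2r _ 2)// ?nnegrE ?addr_ge0 ?enorm_ge0//.
  rewrite enorm_sqr dotv_col_mx sqrrD !enorm_sqr.
  rewrite addrAC lerDl mulrn_wge0// mulr_ge0 ?enorm_ge0//.
lra.
Qed.

(** A Gronwall argument for [E t * V t]. Most of the proof transfers absolute continuity from [z] to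
    this product, by bounding its increments through those of [z] and of time. *)
Lemma abs_continuous_on_decay n (z : R -> 'cV[R]_n) (z0 : 'cV[R]_n) (c T : R) :
  0 < c -> 0 <= T -> abs_continuous_on 0 T z ->
  {ae @lebesgue_measure R, forall t : R, 0 < t -> exists2 dz, is_derive t 1 z dz &
     dotv (z t - z0) dz <= - c * dotv (z t - z0) (z t - z0)} ->
  enorm (z T - z0) <= enorm (z 0 - z0) * expR (- c * T).
Proof.
move=> c0 T0 acz dz.
pose V t := dotv (z t - z0) (z t - z0).
pose E t := expR (2 * c * t).
have [M zM] := abs_continuous_on_bounded T0 acz.
have V0 t : 0 <= V t by exact: dotv_ge0.
have wK (w : 'cV[R]_n) (B : R) : `|w| <= B -> dotv w w <= n%:R * (B * B).
  move=> wB; apply: le_trans (ler_norm _) _; apply: le_trans (dotv_le_norm _ _) _.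
  by rewrite ler_wpM2l// ler_pM.
(* [K] dominates the norm of [(z v - z0) + (z u - z0)], using [r <= 1 + r ^+ 2] to pass from a bound
   on the square. *)
pose K := 1 + n%:R * ((2 * (M + `|z0|)) * (2 * (M + `|z0|))).
pose M2 := n%:R * ((M + `|z0|) * (M + `|z0|)).
have zz0 t : 0 <= t -> t <= T -> `|z t - z0| <= M + `|z0|.
  by move=> t0 tT; apply: le_trans (ler_normB _ _) _; rewrite lerD2r zM.
have VM t : 0 <= t -> t <= T -> V t <= M2.
  by move=> t0 tT; apply: wK; exact: zz0.
have M0 : 0 <= M + `|z0| by apply: le_trans (zz0 0 (lexx 0) T0).
have M20 : 0 <= M2 by rewrite !mulr_ge0.
have K0 : 0 < K by rewrite ltr_wpDr// !mulr_ge0.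
have VV u v : 0 <= u -> u <= v -> v <= T -> V v - V u <= K * enorm (z v - z u).
  move=> u0 uv vT.
  have -> : V v - V u = dotv ((z v - z0) + (z u - z0)) (z v - z u).
    have -> : z v - z u = (z v - z0) - (z u - z0) by rewrite opprB addrA subrK.
    rewrite /V; move: (z v - z0) (z u - z0) => p q.
    by rewrite !dotv_lin (dotvC q p); ring.
  apply: le_trans (CauchySchwarz_dotv _ _) _; rewrite ler_wpM2r ?enorm_ge0//.
  set w := _ + _.
  have wn : `|w| <= 2 * (M + `|z0|).
    rewrite mulr_natl mulr2n; apply: le_trans (ler_normD _ _) _.
    by apply: lerD; apply: zz0 => //; lra.
  have := wK w _ wn; rewrite -enorm_sqr /K.
  have : enorm w <= 1 + enorm w ^+ 2 by nra.
  lra.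
have E0 t : 0 < E t by exact: expR_gt0.
have ET t : t <= T -> E t <= E T.
  by move=> tT; rewrite ler_expR ler_pM2l// mulr_gt0.
(* The tangent bound [1 + x <= expR x] at [x = - (2 * c * (v - u))] plays the part of the mean value
   theorem. *)
have EE u v : u <= v -> v <= T -> E v - E u <= E T * (2 * c) * (v - u).
  move=> uv vT.
  have -> : E u = E v * expR (- (2 * c * (v - u))).
    by rewrite /E -expRD; congr expR; ring.
  have := expR_ge1Dx (- (2 * c * (v - u))); set ex := expR _ => h.
  apply: (@le_trans _ _ (E v * (2 * c * (v - u)))).
    by rewrite -[X in X - _]mulr1 -mulrBr ler_pM2l//; lra.
  rewrite -[leRHS]mulrA ler_wpM2r ?ET// mulr_ge0//; first by rewrite mulr_ge0// ltW.
  by rewrite subr_ge0.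
have WW u v : 0 <= u -> u <= v -> v <= T -> E v * V v - E u * V u <=
    E T * K * enorm (z v - z u) + E T * (2 * c) * M2 * (v - u).
  move=> u0 uv vT.
  have -> : E v * V v - E u * V u = E v * (V v - V u) + (E v - E u) * V u by ring.
  apply: lerD.
    apply: (@le_trans _ _ (E v * (K * enorm (z v - z u)))).
      by rewrite ler_pM2l// VV.
    by rewrite -[leRHS]mulrA ler_wpM2r ?ET// mulr_ge0 ?enorm_ge0// ltW.
  rewrite [leRHS]mulrAC ler_pM ?EE//; last by apply: VM => //; lra.
  by rewrite subr_ge0 ler_expR ler_pM2l// mulr_gt0.
have : E T * V T <= E 0 * V 0.
  apply: (@abs_cont_ae_derive_le0 _ 0 T (fun t => E t * V t)) => //.
    move=> e e0.
    have A10 : 0 < E T * K + 1 by rewrite ltr_wpDl// mulr_ge0// ltW.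
    have A20 : 0 < E T * (2 * c) * M2 + 1.
      by rewrite ltr_wpDl// !mulr_ge0// ltW.
    (* Each of the two terms of [WW] is allotted [e / 2]; the added 1 keeps both denominators
       positive. *)
    have [d d0 zd] := acz (e / 2 / (E T * K + 1)) (divr_gt0 (divr_gt0 e0 (ltr0Sn _ 1)) A10).
    exists (Num.min d (e / 2 / (E T * (2 * c) * M2 + 1))) => [|k u v uv tuv].
      by rewrite lt_min d0 !divr_gt0.
    rewrite lt_min => /andP[l1]; have := zd k u v uv tuv l1.
    rewrite !ltr_pdivlMr// => S1 S2.
    apply: (@le_lt_trans _ _ (\sum_(i < k) (E T * K * enorm (z (v i) - z (u i)) +
       E T * (2 * c) * M2 * (v i - u i)))).
      by apply: ler_sum => i _; have [? ? ?] := uv i; exact: WW.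
    rewrite big_split/= -!mulr_sumr.
    have s10 : 0 <= \sum_(i < k) enorm (z (v i) - z (u i)).
      by apply: sumr_ge0 => i _; exact: enorm_ge0.
    have s20 : 0 <= \sum_(i < k) (v i - u i).
      by apply: sumr_ge0 => i _; have [? ? ?] := uv i; lra.
    rewrite mulrDr mulr1 in S1; rewrite mulrDr mulr1 in S2.
    rewrite (mulrC (E T * K)) (mulrC (E T * (2 * c) * M2)); lra.
  apply: negligibleS dz; apply: subsetC => t /= dz t0 _.
  have [d Dz dle] := dz t0.
  have DV : is_derive t 1 V (2 * dotv (z t - z0) d) by exact: is_derive_sqr_dist.
  have DE : is_derive t 1 E (2 * c * E t).
    by apply: is_derive_eq; rewrite /GRing.scale/= !mulr1 mulrC.
  have DW : is_derive t 1 (fun t => E t * V t) (E t * (2 * dotv (z t - z0) d) + V t * (2 * c * E t)).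
    exact: is_deriveM.
  case: DW => ? ->; split => //.
  have -> : E t * (2 * dotv (z t - z0) d) + V t * (2 * c * E t) =
    E t * (2 * (dotv (z t - z0) d - - c * V t)) by ring.
  by rewrite pmulr_rle0// pmulr_rle0// subr_le0.
rewrite /E mulr0 expR0 mul1r => WT.
(* Compare squares, then multiply by [expR (2 * c * T)] to recover the bound [WT]. *)
rewrite -(@ler_pXn2r _ 2)// ?nnegrE ?mulr_ge0 ?enorm_ge0 ?expR_ge0//.
rewrite exprMn !enorm_sqr -expRM_natl -(@ler_pM2l _ (expR (2 * c * T))) ?expR_gt0//.
rewrite [leRHS]mulrCA -expRD.
have -> : 2 * c * T + 2 * (- c * T) = 0 by rewrite mulNr mulrN mulrA subrr.
by rewrite expR0 mulr1.
Qed.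

End Decay.

(** * Saddle points and trajectories of the reduced dynamics *)

Section ReducedDynamics.
Context {R : realType} {m ns nc : nat}.
Variables (fs : 'cV[R]_ns -> R) (fc : 'cV[R]_nc -> R).
Variables (As : 'M[R]_(m, ns)) (Ac : 'M[R]_(m, nc)) (b : 'cV[R]_m).
Variables (mus ls muc kappas : R).
Hypotheses (mus0 : 0 < mus) (ls0 : 0 < ls) (muc0 : 0 < muc) (kappas0 : 0 < kappas).
Hypotheses (dfs : forall x, differentiable fs x) (dfc : forall x, differentiable fc x).
Hypotheses (scs : strongly_convex mus fs) (scc : strongly_convex muc fc).
Hypothesis lips : lipschitz_gradient ls fs.
Hypothesis Asl : loewner_le kappas%:M (As *m As^T).

Let Lbar := reduced_lagrangian fs fc As Ac b.
Let xs := argmin As mus0 dfs scs.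
Let hs := inner_min As mus0 dfs scs.

Lemma lagrangianE x xc y :
  lagrangian fs fc As Ac b x xc y =
  inner_obj fs As y x + (fc xc + dotv y (Ac *m xc - b)).
Proof. by rewrite /lagrangian dotvE /inner_obj !dotv_lin; ring. Qed.

Lemma lagrangian_minimizer_argmin xc y x :
  lagrangian_minimizer fs fc As Ac b xc y x <-> x = xs y.
Proof.
rewrite -(argmin_unique As mus0 dfs scs).
by split=> H x'; have := H x'; rewrite !lagrangianE lerD2r.
Qed.

(** The infimum is attained at [xs y], so it is a true minimum and the default value of [inf] does
    not arise. *)
Lemma reduced_lagrangianE xc y : Lbar xc y = hs y + (fc xc + dotv y (Ac *m xc - b)).
Proof.
apply/eqP; rewrite eq_le; apply/andP; split.
  apply: ge_inf; last by exists (xs y) => //; rewrite lagrangianE.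
  exists (hs y + (fc xc + dotv y (Ac *m xc - b))) => _ [x _ <-].
  by rewrite lagrangianE lerD2r; exact: argminP.
apply: lb_le_inf; first by exists (lagrangian fs fc As Ac b 0 xc y), 0.
by move=> _ [x _ <-]; rewrite lagrangianE lerD2r; exact: argminP.
Qed.

Lemma reduced_gradient_xc xc y :
  has_gradient (Lbar ^~ y) xc (gradient fc xc + Ac^T *m y).
Proof.
rewrite (_ : Lbar ^~ y = fun x => fc x + (dotv (Ac^T *m y) x + (hs y - dotv y b))).
  by apply: has_gradientD; [|exact: has_gradient_affine].
by apply/funext => x; rewrite reduced_lagrangianE -dotv_mulmx !dotv_lin; ring.
Qed.

(** The gradient of [Lbar xc] at [y], by [reduced_gradient_y]. *)
Definition dual_slope xc y := As *m xs y + Ac *m xc - b.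

Lemma reduced_gradient_y xc y : has_gradient (Lbar xc) y (dual_slope xc y).
Proof.
rewrite (_ : Lbar xc = fun y => hs y + (dotv (Ac *m xc - b) y + fc xc)).
  rewrite /dual_slope -addrA.
  by apply: has_gradientD; [exact: inner_min_gradient|exact: has_gradient_affine].
by apply/funext => z; rewrite reduced_lagrangianE (dotvC z); ring.
Qed.

Lemma kappas_dotv_le (d : 'cV[R]_m) :
  kappas * dotv d d <= dotv (As^T *m d) (As^T *m d).
Proof.
have [_ /(_ d)] := Asl; rewrite -mulmxA dotvE mulmxBl dotvDr dotvNr subr_ge0.
by rewrite mul_scalar_mx dotvZr -mulmxA (dotv_mulmx d As).
Qed.

(** The lower bound on [As *m As^T] converts the loss in [|As^T d|^2] into one in [|d|^2]; this is
    the origin of the rate [kappas / ls]. *)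
Lemma inner_min_le_strong y y' :
  hs y' <= hs y + dotv (y' - y) (As *m xs y)
    - kappas / ls / 2 * dotv (y' - y) (y' - y).
Proof.
have := inner_min_le_quad As mus0 dfs scs y (y' - y) ls0 lips.
rewrite addrC subrK => /le_trans; apply; rewrite lerD2l lerN2.
have -> : kappas / ls / 2 = (2 * ls)^-1 * kappas by field; rewrite gt_eqF.
by rewrite -mulrA ler_pM2l ?kappas_dotv_le// invr_gt0 mulr_gt0.
Qed.

(** Add the strong convexity inequalities of [fc] at [x] and [x'] and the strong concavity
    inequalities of [hs] at [y] and [y']: function values cancel and the halved moduli double. The
    coupling through [Ac] is skew and drops out. *)
Lemma reduced_field_monotone (x x' : 'cV[R]_nc) (y y' : 'cV[R]_m) :
  - dotv (x - x') (gradient fc x + Ac^T *m y - (gradient fc x' + Ac^T *m y'))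
  + dotv (y - y') (dual_slope x y - dual_slope x' y')
  <= - Num.min muc (kappas / ls) *
     (dotv (x - x') (x - x') + dotv (y - y') (y - y')).
Proof.
set c := Num.min _ _.
have cx : c * dotv (x - x') (x - x') <= muc * dotv (x - x') (x - x').
  by rewrite ler_wpM2r ?dotv_ge0// ge_min lexx.
have cy : c * dotv (y - y') (y - y') <= kappas / ls * dotv (y - y') (y - y').
  by rewrite ler_wpM2r ?dotv_ge0// ge_min lexx orbT.
have := strongly_convex_gradient (x - x') scc (dfc x').
have := strongly_convex_gradient (x' - x) scc (dfc x).
have := inner_min_le_strong y y'; have := inner_min_le_strong y' y.
rewrite (addrCA x') subrr addr0 (addrCA x) subrr addr0.
rewrite -(opprB x x') -(opprB y y').
have -> : gradient fc x + Ac^T *m y - (gradient fc x' + Ac^T *m y') =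
    (gradient fc x - gradient fc x') + Ac^T *m (y - y').
  by rewrite mulmxBr opprD addrACA.
have -> : dual_slope x y - dual_slope x' y' =
    As *m xs y - As *m xs y' + Ac *m (x - x').
  by rewrite /dual_slope mulmxBr opprB addrA subrK opprD addrACA.
rewrite [dotv _ (_ + Ac *m _)]dotvDr (dotv_mulmx (y - y') Ac).
move: cx cy; move: (x - x') (y - y') => p q.
rewrite !dotv_lin !opprK !(dotvC p (gradient _ _)) (dotvC p (_ *m _)).
lra.
Qed.

Lemma saddle_point_foc (z : 'cV[R]_nc * 'cV[R]_m) : saddle_point fs fc As Ac b z ->
  gradient fc z.1 + Ac^T *m z.2 = 0 /\
  forall y, nonneg_vec y -> dotv (y - z.2) (dual_slope z.1 z.2) <= 0.
Proof.
move=> [z20 zs]; split.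
  have [dF gF] := reduced_gradient_xc z.1 z.2.
  set v := _ + _ in gF *.
  apply/dotv_eq0/eqP; rewrite eq_le dotv_ge0 andbT.
  rewrite -oppr_ge0 -dotvNr -{1}gF; apply: dotv_gradient_ge0 => // t _ _.
  exact: (zs _ _ z20).2.
move=> y y0; have [dF gF] := has_gradientN (reduced_gradient_y z.1 z.2).
rewrite dotvC -oppr_ge0 -dotvNl -gF; apply: dotv_gradient_ge0 => // t t0 t1.
(* For [t] in []0, 1]] the test point is a convex combination of [z.2] and [y], so it stays in the
   orthant. *)
rewrite lerN2; apply: (zs 0 _ _).1 => j; rewrite !mxE.
have := z20 j; have := y0 j; nra.
Qed.

Lemma saddle_point_exists : exists z, saddle_point fs fc As Ac b z.
Proof.
(* [q] is the dual function: the part in [xc] is minimized too, by the same construction applied to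
   [fc] and [Ac]. *)
pose xc := argmin Ac muc0 dfc scc; pose hc := inner_min Ac muc0 dfc scc.
pose q y := hs y + (hc y + (dotv (- b) y + 0)).
pose gq y := As *m xs y + (Ac *m xc y - b).
have gqE y : has_gradient q y (gq y).
  apply: has_gradientD; first exact: inner_min_gradient.
  by apply: has_gradientD; [exact: inner_min_gradient|exact: has_gradient_affine].
have [||||y y1|y y0 ymax] := @exists_min_coercive R m [set y | nonneg_vec y]
    (fun y => - q y) (- q 0) (kappas / ls) (- gq 0).
- by exists 0 => j; rewrite mxE.
- rewrite (_ : mkset _ = \bigcap_j [set y : 'cV[R]_m | 0 <= y j ord0]).
    apply: closed_bigI => j _.
    apply: (@preimage_closed _ _ (fun y : 'cV[R]_m => y j ord0) [set r | 0 <= r]).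
      by move=> y _; exact: coord_continuous.
    exact: closed_ge.
  by apply/seteqP; split=> [y y0 j _|y y0 j]; [exact: y0|exact: (y0 j)].
- move=> y; apply: differentiable_continuous.
  by case: (has_gradientN (gqE y)).
- by rewrite divr_gt0.
(* Coercivity of [- q] comes from strong concavity of [hs] at 0 and the affine upper bound for
   [hc]. *)
- have := inner_min_le_strong 0 y; have := inner_min_le_affine Ac muc0 dfc scc 0 y.
  rewrite subr0 add0r /q -/hc /gq !dotv_lin !addr0.
  rewrite !(dotvC y) (dotvC b 0) !dotv0l -/xc; lra.
(* First-order optimality of [y] for [q] over the convex orthant, as a variational inequality. *)
have VI y' : nonneg_vec y' -> dotv (y' - y) (gq y) <= 0.
  move=> y'0; have [dF gF] := has_gradientN (gqE y).
  rewrite dotvC -oppr_ge0 -dotvNl -gF; apply: dotv_gradient_ge0 => // t t0 t1.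
  apply: ymax => j; rewrite !mxE.
  have := y0 j; have := y'0 j; nra.
exists (xc y, y); split=> // x y' y'0 /=; rewrite -!/(Lbar _ _) !reduced_lagrangianE.
split.
  (* Maximality in [y]: [hs] lies below its tangent, whose slope combined with the [Ac] term is
     [gq y], and [VI] fixes the sign. Minimality in [xc] is the definition of [xc y]. *)
  have := inner_min_le_affine As mus0 dfs scs y (y' - y).
  have := VI y' y'0; rewrite [y + _]addrC subrK /gq dotvDr -/hs -/xs.
  by rewrite !dotv_lin; lra.
rewrite lerD2l !dotvDr !addrA lerD2r; exact: argminP.
Qed.

(** Each point tested in the variational inequality of the other makes the monotone pairing
    nonnegative, which forces the squared distance to vanish. *)
Lemma saddle_point_unique z z' : saddle_point fs fc As Ac b z ->
  saddle_point fs fc As Ac b z' -> z = z'.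
Proof.
move=> sz sz'; have [gz VIz] := saddle_point_foc sz.
have [gz' VIz'] := saddle_point_foc sz'.
have := reduced_field_monotone z.1 z'.1 z.2 z'.2.
rewrite gz gz' subrr dotvC dotv0l oppr0 add0r.
have := VIz _ sz'.1; have := VIz' _ sz.1.
rewrite -(opprB z.2) dotvNl dotvDr dotvNr => h1 h2 h3.
have c0 : 0 < Num.min muc (kappas / ls) by rewrite lt_min muc0 divr_gt0.
have x0 := dotv_ge0 (z.1 - z'.1); have y0 := dotv_ge0 (z.2 - z'.2).
have : Num.min muc (kappas / ls) * (dotv (z.1 - z'.1) (z.1 - z'.1) + dotv (z.2 - z'.2) (z.2 - z'.2)) <= 0 by lra.
rewrite pmulr_rle0// => s0.
have /dotv_eq0/subr0_eq : dotv (z.1 - z'.1) (z.1 - z'.1) = 0 by lra.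
have /dotv_eq0/subr0_eq : dotv (z.2 - z'.2) (z.2 - z'.2) = 0 by lra.
by case: z z' {sz sz' gz VIz gz' VIz' h1 h2 h3 x0 y0 s0} => [? ?] [? ?] /= -> ->.
Qed.

(** The projection changes only coordinates with [y j = 0]; there it can only raise [s j], while the
    factor [y j - y' j] is nonpositive. *)
Lemma dotv_proj_plus_le (y y' s : 'cV[R]_m) : nonneg_vec y -> nonneg_vec y' ->
  dotv (y - y') (proj_plus y s) <= dotv (y - y') s.
Proof.
move=> y0 y'0; apply: ler_sum => j _; rewrite !mxE.
case: ltP => // yj; have {yj} -> : y j ord0 = 0 by apply/eqP; rewrite eq_le yj y0.
rewrite sub0r !mulNr lerN2 ler_wpM2l//.
by rewrite le_max lexx.
Qed.

Lemma reduced_pd_solution_decay z xc y : saddle_point fs fc As Ac b z ->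
  reduced_pd_solution fs fc As Ac b xc y -> forall t, 0 <= t ->
  enorm (col_mx (xc t) (y t) - col_mx z.1 z.2) <=
  enorm (col_mx (xc 0) (y 0) - col_mx z.1 z.2)
    * expR (- Num.min muc (kappas / ls) * t).
Proof.
move=> sz [ac y0 ode] t t0; have [gz VIz] := saddle_point_foc sz.
have [acx acy] := ac t t0.
apply: (@abs_continuous_on_decay R _ (fun t => col_mx (xc t) (y t))) => //.
- by rewrite lt_min muc0 divr_gt0.
- exact: abs_continuous_on_col_mx.
apply: negligibleS ode; apply: subsetC => s /= ode s0.
have [Dx Dy] := ode s0; have D := is_derive_col_mx Dx Dy.
eexists; first exact: D.
rewrite opp_col_mx add_col_mx !dotv_col_mx.
have [_ ->] := reduced_gradient_xc (xc s) (y s).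
have [_ ->] := reduced_gradient_y (xc s) (y s).
have ys : nonneg_vec (y s) by apply: y0; exact: ltW.
(* Remove the projection, compare the field with its value at [z], and discard the nonpositive term
   from [dual_slope z.1 z.2], which need not vanish when a constraint is inactive. *)
have := dotv_proj_plus_le (dual_slope (xc s) (y s)) ys sz.1.
have := reduced_field_monotone (xc s) z.1 (y s) z.2.
have := VIz _ ys.
by rewrite gz subr0 dotvNr (dotvDr _ (- dual_slope _ _)) dotvNr; lra.
Qed.

End ReducedDynamics.

(** The first conjunct ties the gradients of [Lbar] that drive the dynamics to their explicit
    formulas through the minimizer map [xbar]. *)
Theorem mainTheorem19 (R : realType) (m ns nc : nat)
    (fs : 'cV[R]_ns -> R) (fc : 'cV[R]_nc -> R)
    (As : 'M[R]_(m, ns)) (Ac : 'M[R]_(m, nc)) (b : 'cV[R]_m)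
    (mus ls muc lc sigmas kappas : R)
    (mus_gt0 : 0 < mus) (ls_gt0 : 0 < ls) (muc_gt0 : 0 < muc) (lc_gt0 : 0 < lc)
    (sigmas_gt0 : 0 < sigmas) (kappas_gt0 : 0 < kappas)
    (fs_C1 : continuously_differentiable fs)
    (fc_C1 : continuously_differentiable fc)
    (fs_convex : convex fs) (fc_convex : convex fc)
    (fs_strong : strongly_convex mus fs) (fs_lip : lipschitz_gradient ls fs)
    (fc_strong : strongly_convex muc fc) (fc_lip : lipschitz_gradient lc fc)
    (As_full_row_rank : row_free As)
    (As_upper : loewner_le (As *m As^T) sigmas%:M)
    (As_lower : loewner_le kappas%:M (As *m As^T)) :
  let Lbar := reduced_lagrangian fs fc As Ac b in
  let c := Num.min muc (kappas / ls) in
  (exists xbar : 'cV[R]_m -> 'cV[R]_ns,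
    [/\ forall xc y xs,
          lagrangian_minimizer fs fc As Ac b xc y xs <-> xs = xbar y,
        forall xc y,
          has_gradient (Lbar ^~ y) xc (gradient fc xc + Ac^T *m y) &
        forall xc y,
          has_gradient (Lbar xc) y (As *m xbar y + Ac *m xc - b)]) /\
  [/\ 0 < c,
      exists! zstar, saddle_point fs fc As Ac b zstar &
      forall zstar, saddle_point fs fc As Ac b zstar ->
      forall (xc : R -> 'cV[R]_nc) (y : R -> 'cV[R]_m),
        reduced_pd_solution fs fc As Ac b xc y ->
        forall t : R, 0 <= t ->
          enorm (col_mx (xc t) (y t) - col_mx zstar.1 zstar.2) <=
          enorm (col_mx (xc 0) (y 0) - col_mx zstar.1 zstar.2)
            * expR (- c * t)].
Proof.
have [[dfs _] [dfc _]] := (fs_C1, fc_C1).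
split.
  exists (argmin As mus_gt0 dfs fs_strong); split=> xc y.
  - move=> x; exact: lagrangian_minimizer_argmin.
  - exact: (reduced_gradient_xc As Ac b mus_gt0 dfs dfc fs_strong).
  - exact: reduced_gradient_y.
split; first by rewrite lt_min muc_gt0 divr_gt0.
- have [z sz] := saddle_point_exists Ac b mus_gt0 ls_gt0 muc_gt0 kappas_gt0
    dfs dfc fs_strong fc_strong fs_lip As_lower.
  by exists z; split=> // z' sz'; 
    exact: (saddle_point_unique mus_gt0 ls_gt0 muc_gt0 kappas_gt0 dfs dfc
      fs_strong fc_strong fs_lip As_lower sz sz').
- move=> z sz xc y sol t t0; 
  exact: (reduced_pd_solution_decay mus_gt0 ls_gt0 muc_gt0 kappas_gt0 dfs dfc
      fs_strong fc_strong fs_lip As_lower sz sol).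
Qed.
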